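(* Let $m,n,k,p\geq 2$ be integers with $m\leq n$. There exists a positive constant $c=c(k,p)$ such that \[ z(m,n,\theta_{k,p})\le \begin{cases} c\cdot \left[(mn)^{\frac{k+1}{2k}}+m+n\right] & \text{if } k \text{ is odd}, \\ c\cdot \left[m^{\frac{k+2}{2k}}n^{\frac{1}{2}}+m+n\right] & \text{if } k \text{ is even}. \end{cases} \]
   Context: $\theta_{k,p}$ denotes the graph consisting of $p$ internally vertex-disjoint paths of length $k$ joining a fixed pair of vertices. For a graph $H$ and positive integers $m,n$, the asymmetric bipartite Turán number $z(m,n,H)$ is the maximum number of edges in a bipartite graph with parts of sizes $m$ and $n$ that contains no copy of $H$ as a subgraph. *)

(* Defs.v *)
From HB Require Import structures.
From mathcomp Require Import all_boot all_order all_algebra.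
From mathcomp Require Import reals exp.

Set Implicit Arguments.
Unset Strict Implicit.
Unset Printing Implicit Defensive.

Record sgraph := SGraph {
  vertex :> finType;
  adj : rel vertex;
  adj_sym : symmetric adj;
  adj_irr : irreflexive adj }.

(* Subgraph containment, not necessarily induced. *)
Definition contains (G H : sgraph) : bool :=
  [exists f : {ffun H -> G},
     injectiveb f && [forall x, forall y, adj x y ==> adj (f x) (f y)]].

Section Bipartite.
Variables (m n : nat) (E : {set 'I_m * 'I_n}).

Definition bip_adj (u v : 'I_m + 'I_n) : bool :=
  match u, v with
  | inl a, inr b | inr b, inl a => (a, b) \in E
  | _, _ => false
  end.

Lemma bip_adj_sym : symmetric bip_adj.
Proof. by move=> [a|b] [a'|b']. Qed.

Lemma bip_adj_irr : irreflexive bip_adj.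
Proof. by case. Qed.

(* Every bipartite graph with parts of sizes m and n is, up to isomorphism,
   bip_graph E for some E, and its number of edges is then #|E|. *)
Definition bip_graph : sgraph := SGraph bip_adj_sym bip_adj_irr.
End Bipartite.

(* The maximum is over a nonempty family as soon as H has an edge, or more than
   m + n vertices. A copy of H may lie in either orientation with respect to
   the two parts. *)
Definition zturan (m n : nat) (H : sgraph) : nat :=
  \max_(E : {set 'I_m * 'I_n} | ~~ contains (bip_graph E) H) #|E|.

Section Theta.
Variables (k p : nat).

(* inl false and inl true are the two fixed end vertices; inr (j, i) is the
   internal vertex of the j-th path at distance i.+1 from inl false. *)
Definition theta_vertex : finType := (bool + 'I_p * 'I_k.-1)%type.

Definition theta_pos (u : theta_vertex) : nat :=
  match u with
  | inl b => if b then k else 0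
  | inr (_, i) => i.+1
  end.

Definition same_path (u v : theta_vertex) : bool :=
  match u, v with
  | inr (j, _), inr (j', _) => j == j'
  | _, _ => true
  end.

Definition theta_adj (u v : theta_vertex) : bool :=
  same_path u v &&
  ((theta_pos v == (theta_pos u).+1) || (theta_pos u == (theta_pos v).+1)).

Lemma theta_adj_sym : symmetric theta_adj.
Proof.
move=> u v; rewrite /theta_adj orbC; congr (_ && _).
by case: u v => [?|[j i]] [?|[j' i']] //=; rewrite eq_sym.
Qed.

Lemma theta_adj_irr : irreflexive theta_adj.
Proof. by move=> u; rewrite /theta_adj orbb ltn_eqF ?andbF. Qed.

Definition theta : sgraph := SGraph theta_adj_sym theta_adj_irr.
End Theta.

(* Main.v *)
Require Import Defs.
From HB Require Import structures.
From mathcomp Require Import all_boot all_order all_algebra.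
From mathcomp Require Import reals exp.
From mathcomp Require Import zify.
Import Order.TTheory GRing.Theory Num.Theory.
Set Implicit Arguments.
Unset Strict Implicit.
Unset Printing Implicit Defensive.

(**
A breadth-first search argument in the style of Faudree and Simonovits. A
theta-free graph with e edges has a nonempty subgraph with minimum degree at
least e/(4m) on the m-side and e/(4n) on the n-side. Let L_0, L_1, ... be the
distance levels from a vertex of the m-side of that subgraph.

The key point is e(L_i, L_{i+1}) <= C (|L_i| + |L_{i+1}|) for i < k. Let H be
a set of edges between L_i and L_{i+1} such that the H-neighbours in L_i of
each v in L_{i+1} have a common ancestor t+1 steps up the search tree, and
colour u in L_i by its ancestor t steps up. Delete repeatedly the vertices u of
small degree and the vertices v that see few colours, keeping aside, for each
such v, its edges of the most frequent colour. If some edges survive, a greedy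
choice gives p paths of length k - (t+1) which leave a common vertex, zigzag
between the two levels and end in different colours; descending the tree from
the common ancestor completes them to a theta graph. Otherwise the edges kept
aside are a constant proportion of H, up to O(|L_i|), and their common ancestors
lie one step lower. At the start the common ancestor is the root, i steps up;
after i rounds each v has a single neighbour left.

Hence |L_{i+1}| is at least a constant times d |L_i|, where d is the minimum
degree on the side of L_i, and comparing |L_k| with the size of its side bounds
e.
*)

(** * Recognising a theta graph *)

(** A copy is presented as [p] walks [g a], indexed by natural numbers, so that the later
    constructions can do arithmetic on positions. *)
Lemma contains_theta (G : sgraph) (k p : nat) (y z : G) (g : nat -> nat -> G) :
  0 < p -> 0 < k -> y != z ->
  (forall a, a < p -> g a 0 = y) -> (forall a, a < p -> g a k = z) ->
  (forall a t, a < p -> t < k -> adj (g a t) (g a t.+1)) ->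
  (forall a t, a < p -> 0 < t < k -> g a t != y /\ g a t != z) ->
  (forall a b t t', a < p -> b < p -> 0 < t < k -> 0 < t' < k ->
     g a t = g b t' -> a = b /\ t = t') ->
  contains G (theta k p).
Proof.
move=> p0 k0 yz g0 gk gadj gint ginj.
pose f (u : theta k p) : G :=
  match u with inl b => if b then z else y | inr (a, i) => g a i.+1 end.
have lt1 (i : 'I_k.-1) : 0 < i.+1 < k by case: i => /= i; lia.
apply/existsP; exists [ffun u => f u]; apply/andP; split.
  apply/injectiveP => u v; rewrite !ffunE.
  case: u v => [b|[a i]] [b'|[a' i']] /=.
  - by case: b b' => [] [] // e; move: yz; rewrite e eqxx.
  - have [ny nz] := gint a' i'.+1 (ltn_ord _) (lt1 _).
    by case: b => e; [move: nz | move: ny]; rewrite -e eqxx.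
  - have [ny nz] := gint a i.+1 (ltn_ord _) (lt1 _).
    by case: b' => e; [move: nz | move: ny]; rewrite e eqxx.
  - move=> /(ginj _ _ _ _ (ltn_ord _) (ltn_ord _) (lt1 _) (lt1 _)) [ea [ei]].
    by congr (inr (_, _)); apply: val_inj.
(* Only the direction of increasing position is treated; symmetry gives the other. The two ends are
   adjacent only for [k = 1]. *)
have step u v : same_path u v -> theta_pos v = (theta_pos u).+1 ->
    adj (f u) (f v).
  case: u v => [b|[a i]] [b'|[a' i']] //=.
  - case: b b' => [] [] //= _; try lia.
    by move=> k1; rewrite -(g0 0) // -(gk 0) // k1; apply: gadj; rewrite ?k1.
  - case: b => /= _; first by move=> e; case/andP: (lt1 i'); lia.
    by case=> ->; rewrite -(g0 a') //; apply: gadj.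
  - case: b' => // _ e; have := gadj a i.+1 (ltn_ord _).
    by rewrite -e gk //; apply.
  - move=> /eqP -> [e]; rewrite e; apply: gadj => //.
    by case/andP: (lt1 i).
apply/forallP => u; apply/forallP => v; apply/implyP; rewrite !ffunE /=.
case/andP=> sp /orP[] /eqP pos; first exact: step.
rewrite adj_sym; apply: step => //.
by case: u v sp {pos} => [?|[j i]] [?|[j' i']] //=; rewrite eq_sym.
Qed.

Lemma fresh_element (T : finType) (A : {set T}) (s : seq T) :
  size s < #|A| -> exists2 x, x \in A & x \notin s.
Proof.
move=> ltsA; have /subsetPn[x xA xs] : ~~ (A \subset s).
  apply/negP => /subset_leq_card leA.
  by have := leq_trans ltsA (leq_trans leA (card_size s)); rewrite ltnn.
by exists x.
Qed.

(** * Greedy paths with distinct end colours *)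

Section RainbowPaths.
Variables (T C : finType) (H : {set T * T}) (col : T -> C) (Q : nat).
Hypothesis degl : forall u v, (u, v) \in H -> Q <= #|[set w | (u, w) \in H]|.
Hypothesis degr :
  forall u v, (u, v) \in H -> Q <= #|col @: [set w | (w, v) \in H]|.

Let e (a b : T) := ((a, b) \in H) || ((b, a) \in H).

(** The path grows one vertex at a time: [F] gains an element as [l] drops by one, so the budget [Q]
    is respected. The parity test puts [y] on the side for which a path of length [l] ends at a left
    end of an edge. *)
Lemma rainbow_path l y (F : seq T) (K : seq C) :
  size F + size K + l <= Q ->
  (exists w, (if odd l then (w, y) else (y, w)) \in H) ->
  exists s, [/\ size s = l, path e y s, uniq s, {in s, forall w, w \notin F} &
    (0 < l -> col (last y s) \notin K) /\ (exists w, (last y s, w) \in H)].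
Proof.
elim: l y F => [|l IH] y F lQ [w yw].
  by exists [::]; split=> //; split=> //; exists w.
suff [x [exy xF xw xK]] : exists x, [/\ e y x, x \notin F,
    exists w, (if odd l then (w, x) else (x, w)) \in H &
    (l = 0 -> col x \notin K)].
  have [|s [sl ps us sF [sK sw]]] := IH x (x :: F) _ xw.
    by move: lQ => /=; lia.
  exists (x :: s); split => //=.
  - by rewrite sl.
  - by rewrite exy.
  - rewrite us andbT; apply/negP => /sF; by rewrite inE eqxx.
  - move=> z; rewrite inE => /orP[/eqP->//|/sF].
    by rewrite inE negb_or => /andP[].
  - split=> // _; case: (posnP l) => [l0|/sK //].
    by move: sl; rewrite l0 => /size0nil -> /=; apply: xK.
move: yw => /=; case ol: (odd l) => /= yw.
  have [|x] := @fresh_element _ [set w | (y, w) \in H] F.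
    by apply: leq_trans (degl yw); lia.
  rewrite inE => yx xF; exists x; split=> //; first by rewrite /e yx.
    by exists y.
  by move=> l0; move: ol; rewrite l0.
(* A colour not seen on [F] forces a vertex outside [F]; avoiding [K] too settles the last step. *)
have [|c] := @fresh_element _ (col @: [set w | (w, y) \in H]) (map col F ++ K).
  by rewrite size_cat size_map; apply: leq_trans (degr yw); lia.
case/imsetP => x; rewrite inE => xy ->; rewrite mem_cat negb_or => /andP[xF xK].
exists x; split=> //; first by rewrite /e xy orbT.
  by apply: contra xF => /(map_f col).
by exists y.
Qed.

(** Legs are added one by one. A new leg of length [l] must avoid the [1 + q * l] vertices and the
    [q] end colours already used, whence the bound on [Q]. *)
Lemma rainbow_spider q l y :
  0 < l -> 1 + q + q * l + l <= Q ->
  (exists w, (if odd l then (w, y) else (y, w)) \in H) ->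
  exists P : nat -> seq T,
    [/\ forall a, a < q -> [/\ size (P a) = l, path e y (P a), uniq (y :: P a) &
          exists w, (last y (P a), w) \in H],
        forall a b w, a < q -> b < q -> w \in P a -> w \in P b -> a = b &
        forall a b, a < q -> b < q ->
          col (last y (P a)) = col (last y (P b)) -> a = b].
Proof.
move=> l0 + yw.
suff main : 1 + q + q * l + l <= Q -> exists (P : nat -> seq T) (F : seq T),
    [/\ size F = 1 + q * l, y \in F, forall a, a < q -> {subset P a <= F} &
    [/\ forall a, a < q -> [/\ size (P a) = l, path e y (P a), uniq (y :: P a) &
          exists w, (last y (P a), w) \in H],
        forall a b w, a < q -> b < q -> w \in P a -> w \in P b -> a = b &
        forall a b, a < q -> b < q ->
          col (last y (P a)) = col (last y (P b)) -> a = b]].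
  by move/main => [P [F [_ _ _ ?]]]; exists P.
elim: q => [|q IH] lQ.
  by exists (fun=> [::]), [:: y]; split; rewrite ?inE ?mul0n.
have [|P [F [sF yF PF [gP dP cP]]]] := IH; first by lia.
have [|s [sl ps us sNF [sK sw]]] :=
  @rainbow_path l y F (mkseq (fun a => col (last y (P a))) q) _ yw.
  by rewrite size_mkseq sF; lia.
have {}sK a : a < q -> col (last y (P a)) <> col (last y s).
  move=> aq eq; move: (sK l0); rewrite -eq.
  by rewrite (map_f (fun a => col (last y (P a)))) // mem_iota.
exists (fun a => if a == q then s else P a), (s ++ F); split.
- by rewrite size_cat sl sF; lia.
- by rewrite mem_cat yF orbT.
- move=> a aq w; rewrite mem_cat; case: eqP => [_ -> //|/eqP naq].
  by move/PF => -> //; rewrite ?orbT //; lia.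
split.
- move=> a aq; case: eqP => [_|/eqP naq]; last by apply: gP; lia.
  split=> //=; rewrite us andbT; by apply: contraL yF => /sNF.
- move=> a b w aq bq; case: eqP => [->|/eqP na]; case: eqP => [-> //|/eqP nb].
  + by move=> /sNF /negP nF /PF wF; case: nF; apply: wF; lia.
  + by move=> /PF wF /sNF /negP nF; case: nF; apply: wF; lia.
  + by apply: dP; lia.
- move=> a b aq bq; case: eqP => [->|/eqP na]; case: eqP => [-> //|/eqP nb].
  + by move/esym/sK => -/(_ _) []; lia.
  + by move/sK => -/(_ _) []; lia.
  + by apply: cP; lia.
Qed.
End RainbowPaths.

(** * Counting edges at a vertex, and pigeonhole *)

Lemma card_edges_from (S T : finType) (H : {set S * T}) u :
  #|[set e in H | e.1 == u]| = #|[set w | (u, w) \in H]|.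
Proof.
rewrite -[RHS](card_imset _ (f := pair u)); last by move=> ? ? [].
apply: eq_card => -[a b]; rewrite inE /=.
apply/andP/imsetP => [[ab /eqP e]|[w]].
  by exists b; rewrite ?inE -e.
by rewrite inE => uw [-> ->].
Qed.

Lemma card_edges_to (S T : finType) (H : {set S * T}) v :
  #|[set e in H | e.2 == v]| = #|[set w | (w, v) \in H]|.
Proof.
rewrite -[RHS](card_imset _ (f := pair^~ v)); last by move=> ? ? [].
apply: eq_card => -[a b]; rewrite inE /=.
apply/andP/imsetP => [[ab /eqP e]|[w]].
  by exists a; rewrite ?inE -e.
by rewrite inE => uw [-> ->].
Qed.

Lemma card_edges_not_from (S T : finType) (H : {set S * T}) u :
  #|H| = #|[set w | (u, w) \in H]| + #|[set e in H | e.1 != u]|.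
Proof.
rewrite -card_edges_from -(cardsID [set e | e.1 == u] H).
by congr (_ + _); apply: eq_card => e; rewrite !inE // andbC.
Qed.

Lemma card_edges_not_to (S T : finType) (H : {set S * T}) v :
  #|H| = #|[set w | (w, v) \in H]| + #|[set e in H | e.2 != v]|.
Proof.
rewrite -card_edges_to -(cardsID [set e | e.2 == v] H).
by congr (_ + _); apply: eq_card => e; rewrite !inE // andbC.
Qed.

(** The most frequent value works; [c0] ensures that some value exists even if [A] is empty. *)
Lemma large_fiber (S T : finType) (A : {set S}) (h : S -> T) (c0 : T) q :
  #|h @: A| <= q -> exists c, #|A| <= q * #|[set x in A | h x == c]|.
Proof.
move=> hq; pose fib c := #|[set x in A | h x == c]|.
case: (@arg_maxnP _ c0 xpredT fib) => // c _ cmax.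
exists c; rewrite -sum1_card (partition_big_imset h) /=.
apply: leq_trans (leq_mul hq (leqnn _)); rewrite -sum_nat_const.
apply: leq_sum => d _.
apply: leq_trans (cmax d isT); rewrite /fib -sum1_card leq_eqVlt; apply/orP; left.
by apply/eqP/eq_bigl => x; rewrite !inE.
Qed.

(* The greedy choice of p paths never has to avoid more than 1 + p k vertices and
   p colours. *)
Definition theta_degree k p := 1 + p + p * k + k.

(** * Edges between consecutive levels *)

Section LevelEdges.
Variables (G : sgraph) (i : nat) (rk : G -> nat) (par : G -> G).
Hypothesis par_rk : forall u, 0 < rk u <= i -> rk (par u) = (rk u).-1.

Lemma rk_iter_par u t : rk u = i -> t <= i -> rk (iter t par u) = i - t.
Proof.
move=> ui; elim: t => [|t IH] ti; first by rewrite subn0.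
by rewrite iterS par_rk IH; lia.
Qed.

Variables k p : nat.
Hypotheses (p0 : 0 < p) (ik : i < k).
Hypothesis par_adj : forall u, 0 < rk u <= i -> adj (par u) u.

Let Q := theta_degree k p.

Definition level_edges (H : {set G * G}) :=
  forall u v, (u, v) \in H -> [/\ rk u = i, i < rk v & adj u v].

(** Each path zigzags for [l] edges from [y] to level [i], then takes [t.+1] parent steps to [z].
    After the zigzag all ranks are below [i], so tree parts avoid zigzags; distinct end colours keep
    the tree parts disjoint before [z]. *)
Lemma theta_of_level_edges (H : {set G * G}) t z : level_edges H ->
  t < i -> H != set0 ->
  (forall u v, (u, v) \in H -> iter t.+1 par u = z) ->
  (forall u v, (u, v) \in H -> Q <= #|[set w | (u, w) \in H]|) ->
  (forall u v, (u, v) \in H -> Q <= #|iter t par @: [set w | (w, v) \in H]|) ->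
  contains G (theta k p).
Proof.
move=> lH ti /set0Pn[[u0 v0] uv0] Hz degl degr.
pose l := k - t.+1.
have l0 : 0 < l by rewrite /l; lia.
have lk : l < k by rewrite /l; lia.
(* This choice makes the zigzag end in level [i], where the parent steps start. *)
pose y := if odd l then v0 else u0.
have yw : exists w, (if odd l then (w, y) else (y, w)) \in H.
  by rewrite /y; case: odd; [exists u0 | exists v0].
have [|P [gP dP cP]] := rainbow_spider degl degr (q := p) l0 _ yw.
  by rewrite /Q /theta_degree !leq_add ?leq_mul2l // ltnW // orbT.
have yrk : i <= rk y.
  by rewrite /y; case: (lH _ _ uv0) => ? ? _; case: odd; lia.
have Prk a w : a < p -> w \in P a -> i <= rk w.
  move=> /gP[_ + _ _]; elim: (P a) y {yrk yw gP dP cP} => //= x s IH y'.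
  case/andP=> exy /IH {}IH; rewrite inE => /orP[/eqP->|/IH //].
  by case/orP: exy => /lH [] *; lia.
have last_rk a : a < p -> rk (last y (P a)) = i.
  by move=> /gP[_ _ _ [w /lH[]]].
pose g a s :=
  if s <= l then nth y (y :: P a) s else iter (s - l) par (last y (P a)).
have gE a s : a < p -> l <= s -> g a s = iter (s - l) par (last y (P a)).
  move=> ap ls; rewrite /g; case: ltngtP ls => // <- _.
  rewrite subnn /= -nth_last; case: (gP a ap) => -> _ _ _.
  by rewrite -(prednK l0) /=; apply: set_nth_default;
    case: (gP a ap) => ->; lia.
have grk a s : a < p -> l <= s -> s <= k -> rk (g a s) = i - (s - l).
  by move=> ap ls sk; rewrite gE // rk_iter_par ?last_rk //;
    rewrite /l in ls *; lia.
have gin a s : a < p -> 0 < s <= l -> g a s \in P a.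
  move=> ap /andP[s0 sl]; rewrite /g sl -(prednK s0) /=; apply: mem_nth.
  by case: (gP a ap) => ->; lia.
have gk a : a < p -> g a k = z.
  move=> ap; rewrite gE //; last by lia.
  have -> : k - l = t.+1 by rewrite /l; lia.
  by case: (gP a ap) => _ _ _ [w /Hz].
have zrk : rk z < i.
  rewrite -(Hz _ _ uv0) rk_iter_par //; last by case: (lH _ _ uv0).
  by lia.
apply: (@contains_theta G k p y z g) => //.
- by lia.
- by apply: contraTneq zrk => <-; rewrite -leqNgt.
- move=> a s ap sk; case: (ltnP s l) => sl.
    rewrite /g (ltnW sl) sl; case: (gP a ap) => sz /pathP - /(_ y s) + _ _.
    by rewrite sz => /(_ sl) /orP[] /lH[_ _ //]; rewrite adj_sym.
  rewrite adj_sym (gE a s) // (gE a s.+1) //; last by lia.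
  rewrite subSn // iterS; apply: par_adj.
  by rewrite rk_iter_par ?last_rk //; rewrite /l in sl *; lia.
- move=> a s ap /andP[s0 sk]; case: (leqP s l) => sl.
    have gP' : g a s \in P a by apply: gin; rewrite ?s0.
    split; last by apply: contraTneq zrk => <-; rewrite -leqNgt; apply: Prk gP'.
    by apply: contraTneq gP' => ->; case: (gP a ap) => _ _ /=/andP[].
  have := grk a s ap (ltnW sl) (ltnW sk) => rg.
  split; first by apply: contraTneq yrk => <-; rewrite rg -ltnNge; lia.
  apply: contraTneq isT => gz; move: rg; rewrite gz -(gk a) //.
  by rewrite grk //; rewrite /l in sl *; lia.
- move=> a b s s' ap bp /andP[s0 sk] /andP[s0' sk'].
  case: (leqP s l) => sl; case: (leqP s' l) => sl' eg.
  + have ab : a = b.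
      by apply: (dP _ _ (g a s)) => //; [|rewrite eg];
        apply: gin; rewrite ?s0 ?s0'.
    split=> //; subst b; move: eg; rewrite /g sl sl' => /eqP.
    rewrite nth_uniq; first by move/eqP.
    - by case: (gP a ap) => /= ->.
    - by case: (gP a ap) => /= ->.
    - by case: (gP a ap).
  + have := Prk a _ ap (gin a s ap _); rewrite s0 sl eg grk //; last 2 first.
      by lia.
      by lia.
    by move=> /(_ isT); lia.
  + have := Prk b _ bp (gin b s' bp _); rewrite s0' sl' -eg grk //;
      last 2 first.
      by lia.
      by lia.
    by move=> /(_ isT); lia.
  (* Equal ranks give equal positions. Climbing on to [t] parent steps shows that both legs end in
     the same colour, hence are the same leg. *)
  + have ss : s = s'.
      have := congr1 rk eg; rewrite !grk //; try lia.
    split=> //; subst s'; apply: cP => //; move: eg; rewrite !gE //; try lia.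
    move/(congr1 (iter (t - (s - l)) par)); rewrite -!iterD subnK //.
    by rewrite /l in sl *; lia.
Qed.

(** For [t = 0] each right end has at most one neighbour in [H]. *)
Definition common_ancestor t (H : {set G * G}) :=
  forall u u' v, (u, v) \in H -> (u', v) \in H -> iter t par u = iter t par u'.

Lemma level_edges_sub (H H' : {set G * G}) :
  H' \subset H -> level_edges H -> level_edges H'.
Proof. by move=> /subsetP sH lH u v /sH /lH. Qed.

Lemma common_ancestor_sub t (H H' : {set G * G}) :
  H' \subset H -> common_ancestor t H -> common_ancestor t H'.
Proof. by move=> /subsetP sH cH u u' v /sH + /sH; apply: cH. Qed.

(** Induction on the number of edges. Deleting a left vertex loses fewer than [Q] edges and shrinks
    [A]; a deleted right vertex sees fewer than [Q] colours, so its most frequent one retains a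
    proportion [1 / Q] of its edges. *)
Lemma thin_level_edges t (H : {set G * G}) (A : {set G}) :
  ~~ contains G (theta k p) -> t < i -> level_edges H ->
  common_ancestor t.+1 H -> (forall u v, (u, v) \in H -> u \in A) ->
  exists H' : {set G * G}, [/\ H' \subset H, common_ancestor t H' &
    #|H| <= Q * #|A| + Q * #|H'|].
Proof.
move=> noT ti; have [N] := ubnP #|H|.
elim: N H A => // N IH H A; rewrite ltnS => HN lH cH HA.
have [->|H0] := eqVneq H set0.
  by exists set0; split; rewrite ?cards0 // => u u' v; rewrite inE.
have [/existsP[u /andP[uA du]]|/existsPn lowl] :=
    boolP [exists u, (u \in [set e.1 | e in H]) &&
                     (#|[set w | (u, w) \in H]| < Q)].
  case/imsetP: uA => -[a v] uv /= ea; subst a.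
  pose H1 := [set e in H | e.1 != u].
  have cardH : #|H| = _ + #|H1| :=
    card_edges_not_from H u.
  have H1H : H1 \subset H by apply/subsetP => e; rewrite inE => /andP[].
  have [||||H' [H'1 cH' leH']] := IH H1 (A :\ u).
  - suff : 0 < #|[set w | (u, w) \in H]| by lia.
    by apply/card_gt0P; exists v; rewrite inE.
  - exact: level_edges_sub lH.
  - exact: common_ancestor_sub cH.
  - move=> a b; rewrite !inE /= => /andP[/HA -> ->//].
  exists H'; split=> //; first exact: subset_trans H1H.
  have := cardsD1 u A; rewrite (HA _ _ uv) => ->.
  rewrite mulnDr muln1 cardH.
  move: (Q * #|A :\ u|) (Q * #|H'|) leH' du => x x'; lia.
have [/existsP[v /andP[vB dv]]|/existsPn lowr] :=
    boolP [exists v, (v \in [set e.2 | e in H]) &&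
                     (#|iter t par @: [set w | (w, v) \in H]| < Q)].
  case/imsetP: vB => -[u b] uv /= eb; subst b.
  pose H1 := [set e in H | e.2 != v].
  have cardH : #|H| = _ + #|H1| :=
    card_edges_not_to H v.
  have H1H : H1 \subset H by apply/subsetP => e; rewrite inE => /andP[].
  have [||||H' [H'1 cH' leH']] := IH H1 A.
  - suff : 0 < #|[set w | (w, v) \in H]| by lia.
    by apply/card_gt0P; exists u; rewrite inE.
  - exact: level_edges_sub lH.
  - exact: common_ancestor_sub cH.
  - by move=> a b; rewrite !inE /= => /andP[/HA].
  have [c fc] := large_fiber u (ltnW dv).
  pose Hc := [set e in H | (e.2 == v) && (iter t par e.1 == c)].
  have cardHc : #|Hc| =
      #|[set x in [set w | (w, v) \in H] | iter t par x == c]|.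
    rewrite -[RHS](card_imset _ (f := pair^~ v)); last by move=> ? ? [].
    apply: eq_card => -[a b]; rewrite inE /=.
    apply/and3P/imsetP => [[ab /eqP e ec]|[w]].
      by exists a; rewrite ?inE -e // ab.
    by rewrite !inE => /andP[uw ec] [-> ->].
  (* No edge of [H'] ends at [v], so adding [Hc] preserves common ancestors and the cardinals add
     up. *)
  have H'v a : (a, v) \notin H'.
    by apply/negP => /(subsetP H'1); rewrite inE eqxx andbF.
  exists (H' :|: Hc); split.
  - rewrite subUset (subset_trans H'1 H1H).
    by apply/subsetP => e; rewrite inE => /andP[].
  - move=> a a' b; rewrite !inE /=.
    case/orP=> [ab|/and3P[_ /eqP eb /eqP ac]].
      case/orP=> [|/and3P[_ /eqP eb /eqP ac]]; first exact: cH' ab.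
      by move: ab; rewrite eb (negPf (H'v _)).
    rewrite eb (negPf (H'v _)) /= => /and3P[_ _ /eqP ->].
    by rewrite ac.
  - rewrite cardsU; have -> : H' :&: Hc = set0.
      apply/setP => -[a b]; rewrite !inE /=; apply/negbTE/negP.
      by case/andP=> + /and3P[_ /eqP eb _]; rewrite eb (negPf (H'v _)).
    by rewrite cards0 subn0 mulnDr cardH cardHc; lia.
case/negP: noT; case/set0Pn: H0 => -[u0 v0] uv0.
(* All neighbours of a right end share the ancestor at [t.+1] steps, so [Hz] keeps every edge of [H]
   at the vertices it meets: degrees and colour counts are unchanged. *)
pose Hz := [set e in H | iter t.+1 par e.1 == iter t.+1 par u0].
have HzH : Hz \subset H by apply/subsetP => e; rewrite inE => /andP[].
apply: (@theta_of_level_edges Hz t (iter t.+1 par u0)) => //.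
- exact: level_edges_sub lH.
- by apply/set0Pn; exists (u0, v0); rewrite inE uv0 eqxx.
- by move=> u v; rewrite inE => /andP[_ /eqP].
- move=> u v; rewrite inE => /andP[uv uz].
  have := lowl u; rewrite negb_and -leqNgt => /orP[|dQ].
    by case/negP; apply/imsetP; exists (u, v).
  apply: leq_trans dQ (subset_leq_card _).
  apply/subsetP => w; rewrite !inE => ->.
  exact: uz.
- move=> u v; rewrite inE => /andP[uv uz].
  have := lowr v; rewrite negb_and -leqNgt => /orP[|dQ].
    by case/negP; apply/imsetP; exists (u, v).
  apply: leq_trans dQ (subset_leq_card _); apply: imsetS.
  apply/subsetP => w; rewrite !inE => wv; rewrite wv andTb -(eqP uz).
  by apply/eqP; apply: cH wv uv.
Qed.

(** At [t = 0] the right end determines the edge. Each round then costs a factor [2 * Q], one [Q] of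
    which absorbs the term [Q * #|A|]. *)
Lemma card_level_edges t (H : {set G * G}) (A B : {set G}) :
  ~~ contains G (theta k p) -> t <= i -> level_edges H -> common_ancestor t H ->
  (forall u v, (u, v) \in H -> u \in A /\ v \in B) ->
  #|H| <= (2 * Q) ^ t * (#|A| + #|B|).
Proof.
move=> noT; elim: t H => [|t IH] H ti lH cH HAB.
  rewrite mul1n; apply: leq_trans (leq_addl _ _).
  rewrite -(card_in_imset (f := snd) (D := mem H)).
    by apply/subset_leq_card/subsetP => v /imsetP[[a b] /HAB[_ bB] ->].
  by move=> [a b] [a' b'] ab ab' /= eb; subst b'; congr pair; exact: cH ab ab'.
have [|H' [H'H cH' leH]] := thin_level_edges noT ti lH cH (A := A).
  by move=> u v /HAB[].
have := IH H' (ltnW ti) (level_edges_sub H'H lH) cH'.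
move=> /(_ _) IHH; have {IHH} := IHH (fun u v uv => HAB u v (subsetP H'H _ uv)).
have : 0 < (2 * Q) ^ t by rewrite expn_gt0 /Q /theta_degree.
rewrite expnS; set X := _ ^ t => X0 le'.
have : Q * #|H'| <= Q * (X * (#|A| + #|B|)) by rewrite leq_mul2l le' orbT.
have : Q * #|A| <= Q * (X * (#|A| + #|B|)).
  rewrite leq_mul2l; apply/orP; right.
  by apply: leq_trans (leq_pmull _ X0); apply: leq_addr.
by move: leH; rewrite -!mulnA; lia.
Qed.
End LevelEdges.

(** * Breadth-first levels and their growth *)

(* Vertices at distance more than N from x all get rank N.+1. *)
Lemma bfs_rank (T : finType) (e : rel T) (x : T) (N : nat) :
  exists rk : T -> nat, [/\ rk x = 0, forall v, rk v = 0 -> v = x,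
    forall u v, e u v -> rk v <= (rk u).+1 &
    forall v j, rk v = j.+1 -> j < N -> exists2 u, e u v & rk u = j].
Proof.
pose ball := fix ball j : {set T} := if j is j'.+1
  then ball j' :|: [set v | [exists u in ball j', e u v]] else [set x].
pose rk v := find (fun j => v \in ball j) (iota 0 N.+1).
have rkN v : rk v <= N.+1.
  by have := find_size (fun j => v \in ball j) (iota 0 N.+1); rewrite size_iota.
have in_ball v : rk v <= N -> v \in ball (rk v).
  move=> vN; have := @nth_find _ 0 (fun j => v \in ball j) (iota 0 N.+1).
  rewrite nth_iota //; apply; rewrite has_find size_iota //.
have rk_le v j : v \in ball j -> rk v <= j.
  move=> vj; rewrite leqNgt; apply/negP => jv.
  have := @before_find _ 0 (fun j => v \in ball j) (iota 0 N.+1) j jv.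
  by rewrite nth_iota ?add0n ?vj // (leq_trans jv).
exists rk.
have step u v : e u v -> rk v <= (rk u).+1.
  move=> uv; have := rkN u; rewrite leq_eqVlt => /orP[/eqP ->|uN].
    by apply: leq_trans (rkN v) _.
  apply: rk_le; rewrite /= !inE; apply/orP; right.
  by apply/existsP; exists u; rewrite in_ball.
split=> //.
- by apply/eqP; rewrite -leqn0; apply: rk_le; rewrite inE.
- by move=> v v0; have := in_ball v; rewrite v0 inE => /(_ isT)/eqP.
- move=> v j vj jN; have := in_ball v; rewrite vj => /(_ jN).
  rewrite !inE => /orP[/rk_le|/existsP[u /andP[uj uv]]]; first by lia.
  exists u => //; have := rk_le _ _ uj; have := step _ _ uv; lia.
Qed.

Lemma sum_edges_from (S T : finType) (H : {set S * T}) (A : {set S}) :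
  \sum_(u in A) #|[set w | (u, w) \in H]| <= #|H|.
Proof.
rewrite -[X in _ <= X]sum1_card (partition_big fst xpredT) //=.
rewrite [X in _ <= X](bigID (mem A)) /=; apply: leq_trans (leq_addr _ _).
apply: leq_sum => u _; rewrite -card_edges_from -sum1_card.
by rewrite leq_eqVlt; apply/orP; left; apply/eqP/eq_bigl => z; rewrite inE.
Qed.

Lemma sum_edges_to (S T : finType) (H : {set S * T}) (B : {set T}) :
  \sum_(v in B) #|[set w | (w, v) \in H]| <= #|H|.
Proof.
rewrite -[X in _ <= X]sum1_card (partition_big snd xpredT) //=.
rewrite [X in _ <= X](bigID (mem B)) /=; apply: leq_trans (leq_addr _ _).
apply: leq_sum => u _; rewrite -card_edges_to -sum1_card.
by rewrite leq_eqVlt; apply/orP; left; apply/eqP/eq_bigl => z; rewrite inE.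
Qed.

(** The exponent [k] covers the [i] rounds at every level [i < k], so one constant serves all
    levels. *)
Definition theta_const k p := (2 * theta_degree k p) ^ k.

Lemma theta_const_gt0 k p : 0 < theta_const k p.
Proof. by rewrite expn_gt0 /theta_degree. Qed.

Section LevelGrowth.
Variables (G : sgraph) (k p : nat) (x : G) (rk : G -> nat).
Hypotheses (p0 : 0 < p) (noT : ~~ contains G (theta k p)).
Hypotheses (rkx : rk x = 0) (rk0 : forall v, rk v = 0 -> v = x).
Hypothesis rkS : forall u v, adj u v -> rk v <= (rk u).+1.
Hypothesis rk_par :
  forall v j, rk v = j.+1 -> j < k -> exists2 u, adj u v & rk u = j.

Let C := theta_const k p.
Let L i := [set v | rk v == i].
Let E i := [set e : G * G | [&& rk e.1 == i, rk e.2 == i.+1 & adj e.1 e.2]].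

Lemma card_consecutive_levels i : i < k -> #|E i| <= C * (#|L i| + #|L i.+1|).
Proof.
(* The default [u] is not reached for ranks from 1 to [i], where [rk_par] supplies a parent. *)
move=> ik; pose par u := odflt u [pick w | adj w u && (rk w == (rk u).-1)].
have parP u : 0 < rk u <= i -> adj (par u) u && (rk (par u) == (rk u).-1).
  move=> /andP[u0 ui]; rewrite /par; case: pickP => // nopar.
  have [||w wu rw] := rk_par (v := u) (j := (rk u).-1); [lia..|].
  by have := nopar w; rewrite wu rw eqxx.
have par_adj u : 0 < rk u <= i -> adj (par u) u by case/parP/andP.
have par_rk u : 0 < rk u <= i -> rk (par u) = (rk u).-1.
  by case/parP/andP => _ /eqP.
apply: leq_trans (_ : (2 * theta_degree k p) ^ i * (#|L i| + #|L i.+1|) <= _).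
  apply: (card_level_edges par_rk p0 ik par_adj noT) => //.
  - by move=> u v; rewrite inE => /and3P[/eqP /= -> /eqP -> ->].
  (* After [i] parent steps every vertex of level [i] is at the root, so the rounds start at
     [t = i]. *)
  - move=> u u' v; rewrite !inE /= => /and3P[/eqP ui _ _] /and3P[/eqP u'i _ _].
    have anc w : rk w = i -> iter i par w = x.
      by move=> wi; apply: rk0; rewrite (rk_iter_par par_rk wi (leqnn i)) subnn.
    by rewrite !anc.
  - by move=> u v; rewrite !inE /= => /and3P[-> ->].
by rewrite leq_mul2r leq_pexp2l ?orbT ?(ltnW ik) // /theta_degree.
Qed.

Variables (side : G -> bool) (d : bool -> nat).
Hypothesis side_adj : forall u v, adj u v -> side v = ~~ side u.
Hypotheses (sidex : side x = false) (nisox : exists w, adj x w).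
Hypothesis deg_ge : forall u v, adj u v -> d (side u) <= #|[set w | adj u w]|.
Hypothesis dC : forall b, 6 * C <= d b.

Lemma side_rk v : rk v <= k -> side v = odd (rk v).
Proof.
elim: {v}(rk v) {-2}v (erefl (rk v)) => [|j IH] v vj jk.
  by rewrite vj (rk0 vj) sidex.
rewrite vj in jk; have [u uv uj] := rk_par vj jk.
by rewrite (side_adj uv) (IH u uj) ?uj ?vj // ltnW.
Qed.

(** An edge changes the rank by at most one, and not by zero since its ends are on different sides.
    So every edge at level [i] is counted in one of the two adjacent edge sets; level 0 has only
    one. *)
Lemma sum_degrees_level i : i < k ->
  d (odd i) * #|L i| <= (if i is j.+1 then #|E j| else 0) + #|E i|.
Proof.
move=> ik; apply: leq_trans (_ : \sum_(v in L i) #|[set w | adj v w]| <= _).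
  rewrite mulnC -sum_nat_const; apply: leq_sum => v; rewrite inE => /eqP vi.
  have [w vw] : exists w, adj v w.
    case: i ik vi => [|j] ik vi; first by rewrite (rk0 vi).
    by have [w wv _] := rk_par vi (ltnW ik); exists w; rewrite adj_sym.
  by rewrite -vi -side_rk ?vi ?(ltnW ik) //; apply: deg_ge vw.
apply: leq_trans (_ : \sum_(v in L i)
   ((if i is j.+1 then #|[set w | (w, v) \in E j]| else 0)
   + #|[set w | (v, w) \in E i]|) <= _).
  apply: leq_sum => v; rewrite inE => /eqP vi.
  pose U := if i is j.+1 then [set w | (w, v) \in E j] else set0.
  have -> : (if i is j.+1 then #|[set w | (w, v) \in E j]| else 0) = #|U|.
    by rewrite /U; case: (i); rewrite ?cards0.
  apply: leq_trans (_ : #|U :|: [set w | (v, w) \in E i]| <= _); last first.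
    by rewrite cardsU leq_subr.
  apply/subset_leq_card/subsetP => w; rewrite !inE => vw.
  have wv : adj w v by rewrite adj_sym.
  have le1 := rkS vw; have le2 := rkS wv.
  have nrk : rk w != i.
    apply/eqP => wi; have := side_adj vw.
    by rewrite !side_rk ?wi ?vi ?(ltnW ik) //; case: odd.
  rewrite /= vi vw eqxx andbT /=; case: eqP => [_|nw]; first by rewrite orbT.
  rewrite orbF /U; case: (i) vi nrk nw => [|j] vi nrk nw; first by lia.
  rewrite !inE /= vi wv eqxx !andbT; lia.
rewrite big_split /= leq_add ?sum_edges_from //.
by case: (i) => [|j]; rewrite ?sum_edges_to // big1.
Qed.

(** Monotonicity is carried along because the previous level must be bounded by [#|L i|] in the
    degree sum. *)
Lemma level_growth i : i < k ->
  #|L i| <= #|L i.+1| /\ d (odd i) * #|L i| <= 2 * C * #|L i.+1|.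
Proof.
have C0 : 0 < C by exact: theta_const_gt0.
(* As [d c] is at least [6 * C], the term [3 * C * l] is at most half of [d c * l] and can be
   absorbed, which gives the factor 2. *)
have fin c l l' : d c * l <= C * (3 * l + l') ->
    l <= l' /\ d c * l <= 2 * C * l'.
  move=> le; have : 6 * C * l <= d c * l by rewrite leq_mul2r dC orbT.
  rewrite mulnDr mulnCA in le; set D := d _ * l in le * => le2.
  have le3 : 3 * (C * l) <= C * l' by rewrite -mulnA in le2; lia.
  split; last by rewrite -mulnA in le2 *; lia.
  by rewrite -(leq_pmul2l C0); lia.
elim: i => [|i IH] ik; apply: fin.
  apply: leq_trans (sum_degrees_level ik) _; rewrite add0n.
  apply: leq_trans (card_consecutive_levels ik) _.
  by rewrite leq_mul2l; lia.
have [leL _] := IH (ltnW ik).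
apply: leq_trans (sum_degrees_level ik) _.
apply: leq_trans (leq_add (card_consecutive_levels (ltnW ik))
  (card_consecutive_levels ik)) _.
by rewrite -mulnDr leq_mul2l; lia.
Qed.

Lemma prod_degrees_level : \prod_(i < k) d (odd i) <= (2 * C) ^ k * #|L k|.
Proof.
suff main j : j <= k -> \prod_(i < j) d (odd i) <= (2 * C) ^ j * #|L j|.
  exact: main.
elim: j => [|j IH] jk.
  by rewrite big_ord0 mul1n card_gt0; apply/set0Pn; exists x; rewrite inE rkx.
rewrite big_ord_recr /=; apply: leq_trans (leq_mul (IH (ltnW jk)) (leqnn _)) _.
rewrite -mulnA expnSr -mulnA leq_mul2l [#|L j| * _]mulnC.
by have [_ ->] := level_growth jk; rewrite orbT.
Qed.
End LevelGrowth.

(** Multiplying the growth inequalities up to level [k] telescopes, and level [k] lies in the side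
    given by the parity of [k]. *)
Lemma bfs_prod_degrees (G : sgraph) (k p : nat) (side : G -> bool)
    (d : bool -> nat) (x : G) :
  0 < p -> ~~ contains G (theta k p) ->
  (forall u v, adj u v -> side v = ~~ side u) ->
  side x = false -> (exists w, adj x w) ->
  (forall u v, adj u v -> d (side u) <= #|[set w | adj u w]|) ->
  (forall b, 6 * theta_const k p <= d b) ->
  \prod_(i < k) d (odd i) <=
    (2 * theta_const k p) ^ k * #|[set v | side v == odd k]|.
Proof.
move=> p0 noT sadj sx nx deg dC.
have [rk [rkx rk0 rkS rkp]] := bfs_rank (@adj G) x k.
apply: leq_trans
  (prod_degrees_level p0 noT rkx rk0 rkS rkp sadj sx nx deg dC) _.
rewrite leq_mul2l; apply/orP; right; apply/subset_leq_card/subsetP => v.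
by rewrite !inE => /eqP vk; rewrite (side_rk rk0 rkp sadj sx) ?vk.
Qed.

(** * Subgraphs of large minimum degree *)

(** Take an inclusion-minimal edge set satisfying [P], which counts only non-isolated vertices.
    Deleting a left vertex of degree at most [a], or a right one of degree at most [b], would
    preserve [P]. *)
Lemma min_degree_subset (S T : finType) (E : {set S * T}) (a b : nat) :
  a * #|S| + b * #|T| < #|E| ->
  exists E' : {set S * T}, [/\ E' \subset E, E' != set0,
    forall u v, (u, v) \in E' -> a < #|[set w | (u, w) \in E']| &
    forall u v, (u, v) \in E' -> b < #|[set w | (w, v) \in E']|].
Proof.
move=> leE; pose P (F : {set S * T}) :=
  a * #|[set e.1 | e in F]| + b * #|[set e.2 | e in F]| < #|F|.
have PE : P E.
  by apply: leq_ltn_trans leE; rewrite leq_add // leq_mul2l max_card orbT.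
have [F /minsetP[PF minF] FE] := minset_exists (P := P) PE.
have F0 : F != set0.
  by apply: contraTneq PF => ->; rewrite /P !imset0 !cards0 !muln0.
exists F; split=> // u v uv; rewrite ltnNge; apply/negP => low.
- pose F' := [set e in F | e.1 != u].
  have F'F : F' \subset F by apply/subsetP => e; rewrite inE => /andP[].
  have cardF : #|F| = _ + #|F'| :=
    card_edges_not_from F u.
  have : F' = F; last by move/setP/(_ (u, v)); rewrite inE eqxx andbF uv.
  apply: minF => //; rewrite /P.
  have lt1 : #|[set e.1 | e in F']| < #|[set e.1 | e in F]|.
    apply/proper_card/properP; split; first exact: imsetS.
    exists u; first by apply/imsetP; exists (u, v).
    by apply/negP => /imsetP[e + ue]; rewrite inE ue eqxx andbF.
  have le2 : #|[set e.2 | e in F']| <= #|[set e.2 | e in F]|.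
    by apply/subset_leq_card/imsetS.
  have := leq_mul (leqnn a) lt1; have := leq_mul (leqnn b) le2.
  by move: PF; rewrite /P mulnS; lia.
- pose F' := [set e in F | e.2 != v].
  have F'F : F' \subset F by apply/subsetP => e; rewrite inE => /andP[].
  have cardF : #|F| = _ + #|F'| :=
    card_edges_not_to F v.
  have : F' = F; last by move/setP/(_ (u, v)); rewrite inE eqxx andbF uv.
  apply: minF => //; rewrite /P.
  have lt2 : #|[set e.2 | e in F']| < #|[set e.2 | e in F]|.
    apply/proper_card/properP; split; first exact: imsetS.
    exists v; first by apply/imsetP; exists (u, v).
    by apply/negP => /imsetP[e + ue]; rewrite inE ue eqxx andbF.
  have le1 : #|[set e.1 | e in F']| <= #|[set e.1 | e in F]|.
    by apply/subset_leq_card/imsetS.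
  have := leq_mul (leqnn a) le1; have := leq_mul (leqnn b) lt2.
  by move: PF; rewrite /P mulnS; lia.
Qed.

(** * The edge bound in natural numbers *)

Lemma contains_bip_sub m n (E E' : {set 'I_m * 'I_n}) (H : sgraph) :
  E' \subset E -> contains (bip_graph E') H -> contains (bip_graph E) H.
Proof.
move=> /subsetP sE /existsP[f /andP[injf /forallP homf]].
apply/existsP; exists f; rewrite injf /=.
apply/forallP => x; apply/forallP => y.
apply/implyP => xy; have /forallP/(_ y)/implyP/(_ xy) := homf x.
by case: (f x) (f y) => [a|b] [a'|b'] //= /sE.
Qed.

Lemma prod_alternate (d : bool -> nat) k :
  \prod_(i < k) d (odd i) = d false ^ uphalf k * d true ^ k./2.
Proof.
elim: k => [|k IH]; first by rewrite big_ord0.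
rewrite big_ord_recr /= IH uphalf_half.
case: (odd k); rewrite /= ?add1n ?add0n !expnS; lia.
Qed.

Lemma card_theta_free m n k p (E : {set 'I_m * 'I_n}) :
  0 < m -> 0 < n -> 0 < p -> ~~ contains (bip_graph E) (theta k p) ->
  #|E| <= 24 * theta_const k p * (m + n) \/
  #|E| ^ k <= (8 * theta_const k p) ^ k *
    (m ^ uphalf k * n ^ k./2 * (if odd k then n else m)).
Proof.
move=> m0 n0 p0 noT; set C := theta_const k p; set e := #|E|.
have C0 : 0 < C by exact: theta_const_gt0.
(* Then [a * m + b * n] is at most [e / 2], leaving room for a dense subgraph, while [4 * m * a.+1]
   and [4 * n * b.+1] still dominate [e]. *)
pose a := e %/ (4 * m); pose b := e %/ (4 * n).
have ea : e <= 4 * m * a.+1 by rewrite ltnW // mulnC ltn_ceil //; lia.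
have eb : e <= 4 * n * b.+1 by rewrite ltnW // mulnC ltn_ceil //; lia.
have ae : a * (4 * m) <= e by exact: leq_divM.
have be : b * (4 * n) <= e by exact: leq_divM.
have [e0|epos] := posnP e; first by left; rewrite e0.
(* A threshold below [6 * C] already makes [e] linear in [m] or [n], with constant [4 * 6 = 24]. *)
have [aC|aC] := ltnP a.+1 (6 * C).
  left; apply: leq_trans ea _.
  have := leq_mul (leqnn (4 * m)) (ltnW aC); rewrite !mulnDr; lia.
have [bC|bC] := ltnP b.+1 (6 * C).
  left; apply: leq_trans eb _.
  have := leq_mul (leqnn (4 * n)) (ltnW bC); rewrite !mulnDr; lia.
right.
have [|E' [E'E /set0Pn[[u0 v0] uv0] degl degr]] := @min_degree_subset _ _ E a b.
  by rewrite !card_ord -/e; lia.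
pose side (v : bip_graph E') := if v is inl _ then false else true.
pose d c := if c then b.+1 else a.+1.
have : \prod_(i < k) d (odd i) <= (2 * C) ^ k * #|[set v | side v == odd k]|.
  apply: (@bfs_prod_degrees _ _ _ side d (inl u0)) => //.
  - by apply: contra noT; apply: contains_bip_sub.
  - by move=> [u|v] [u'|v'].
  - by exists (inr v0).
  - move=> [u|v] [u'|v'] //= uv.
      apply: leq_trans (degl _ _ uv) _.
      rewrite -(card_imset _ (@inr_inj 'I_m 'I_n)).
      by apply/subset_leq_card/subsetP => _ /imsetP[w + ->]; rewrite !inE.
    apply: leq_trans (degr _ _ uv) _.
    rewrite -(card_imset _ (@inl_inj 'I_m 'I_n)).
    by apply/subset_leq_card/subsetP => _ /imsetP[w + ->]; rewrite !inE.
  - by case.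
rewrite prod_alternate /= => le1.
have le2 : #|[set v | side v == odd k]| <= (if odd k then n else m).
  case: (odd k).
    rewrite -[X in _ <= X](card_ord n) -cardsT.
    rewrite -(card_imset _ (@inr_inj 'I_m 'I_n)).
    apply/subset_leq_card/subsetP => -[u|v]; rewrite inE // => _.
    by apply/imsetP; exists v.
  rewrite -[X in _ <= X](card_ord m) -cardsT.
  rewrite -(card_imset _ (@inl_inj 'I_m 'I_n)).
  apply/subset_leq_card/subsetP => -[u|v]; rewrite inE // => _.
  by apply/imsetP; exists u.
have kE : uphalf k + k./2 = k.
  by rewrite uphalf_half -addnA addnn odd_double_half.
have pow2 y : y ^ k = y ^ uphalf k * y ^ k./2 by rewrite -expnD kE.
(* The factors of [e ^ k] are split as the degrees alternate along the levels: [uphalf k] on the [m]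
   side, [k./2] on the [n] side. *)
rewrite [e ^ k]pow2.
have mono y z j : y <= z -> y ^ j <= z ^ j.
  by case: j => // j yz; rewrite leq_exp2r.
apply: leq_trans (leq_mul (mono _ _ _ ea) (mono _ _ _ eb)) _.
have -> : (4 * m * a.+1) ^ uphalf k * (4 * n * b.+1) ^ k./2 =
    4 ^ k * (m ^ uphalf k * n ^ k./2) * (a.+1 ^ uphalf k * b.+1 ^ k./2).
  by rewrite pow2 !expnMn; lia.
apply: leq_trans (leq_mul (leqnn _) (leq_trans le1 (leq_mul (leqnn _) le2))) _.
have -> : (8 * C) ^ k = 4 ^ k * (2 * C) ^ k by rewrite -expnMn mulnA.
lia.
Qed.

(** * Passage to real exponents *)

Local Open Scope ring_scope.

Lemma powR_ratX (R : realType) (y : R) (a b k j : nat) :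
  0 <= y -> (0 < b)%N -> (a * k = j * b)%N ->
  (y `^ (a%:R / b%:R)) ^+ k = y ^+ j.
Proof.
move=> y0 b0 eab; rewrite -powR_mulrn ?powR_ge0 // -powRrM -powR_mulrn //.
have bR : b%:R != 0 :> R by rewrite pnatr_eq0 -lt0n.
by congr (_ `^ _); rewrite mulrAC -natrM eab natrM mulfK.
Qed.

Theorem theorem1p11 (R : realType) (k p : nat) (hk : (2 <= k)%N) (hp : (2 <= p)%N) :
  exists c : R, 0 < c /\
    forall m n : nat, (2 <= m)%N -> (2 <= n)%N -> (m <= n)%N ->
      (zturan m n (theta k p))%:R <=
        if odd k
        then c * ((m * n)%N%:R `^ ((k + 1)%N%:R / (2 * k)%N%:R) + m%:R + n%:R)
        else c * (m%:R `^ ((k + 2)%N%:R / (2 * k)%N%:R) * n%:R `^ (1 / 2)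
                  + m%:R + n%:R).
Proof.
set C := theta_const k p; have C0 : (0 < C)%N by exact: theta_const_gt0.
(* The linear alternative requires [24 * C]; the other one only [8 * C]. *)
exists (24 * C)%:R; split; first by rewrite ltr0n muln_gt0.
move=> m n m2 n2 _.
pose X : R := if odd k then (m * n)%N%:R `^ ((k + 1)%N%:R / (2 * k)%N%:R)
  else m%:R `^ ((k + 2)%N%:R / (2 * k)%N%:R) * n%:R `^ (1 / 2).
have X0 : 0 <= X by rewrite /X; case: odd; rewrite ?mulr_ge0 ?powR_ge0.
(* The [k]-th power of the main term is the integer in the power alternative: the last factor
   completes [(m * n) ^ uphalf k] for odd [k], and raises the exponent of [m] to [k./2 + 1] for even
   [k]. *)
have XE : X ^+ k = (m ^ uphalf k * n ^ k./2 * (if odd k then n else m))%N%:R.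
  rewrite /X; have := odd_double_half k; have := uphalf_half k.
  case: (odd k) => ku kh.
    rewrite (@powR_ratX _ _ _ _ _ (uphalf k)) ?ler0n //; [|lia|nia].
    by rewrite -natrX expnMn -mulnA -expnSr ku.
  rewrite exprMn (@powR_ratX _ _ _ _ _ (uphalf k).+1) ?ler0n //; [|lia|nia].
  rewrite (@powR_ratX _ _ 1 2 _ (k./2)) ?ler0n //; last by lia.
  by rewrite -!natrX -natrM expnSr mulnAC.
suff main : (zturan m n (theta k p))%:R <= (24 * C)%:R * (X + m%:R + n%:R).
  by move: main; rewrite /X; case: odd.
(* The bound is shown for each [E]; the case of value 0 covers an empty family. *)
rewrite /zturan; elim/big_ind: _ => [|a b ha hb|E noT].
- by rewrite mulr_ge0 // !addr_ge0.
- by case: (leqP a b).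
have [|||le|le] := card_theta_free (m := m) (n := n) (p := p) _ _ _ noT;
  [lia..| |].
  apply: le_trans (_ : (24 * C * (m + n))%:R <= _); first by rewrite ler_nat.
  by rewrite natrM ler_wpM2l // natrD -addrA lerDr.
apply: le_trans (_ : (8 * C)%:R * X <= _); last first.
  by rewrite ler_pM // ?ler_nat ?leq_mul2r ?orbT // -addrA lerDl addr_ge0.
rewrite -(ler_pXn2r (n := k)) ?nnegrE ?mulr_ge0 //; last by lia.
by rewrite exprMn XE -!natrX -natrM ler_nat.
Qed.
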